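(* Let $p$ and $q$ be coprime, let $r$ and $q$ also be coprime, and set $c=\dfrac{\pi r}{q}$. Let $\beta(t)$ be a smooth function such that $|\beta(t)|<\dfrac{\pi}{4}$ and $\beta(t+c)=-\beta(t)$. Let $\rho_1(t)$ and $\rho_2(t)$ satisfy the differential equations $$\rho_1'=(\beta'+1)\tan 2\beta,\qquad \rho_2'=(\beta'-1)\tan 2\beta .$$ Then the curve $\gamma(t)$ whose polar coordinates (polar angle, radius) are $$\left(t-\beta(t)-\frac{\pi p}{q},\ e^{\rho_1(t)}\right)$$ is self-dual.
   Context: Let $V=\mathbb R^3$, let $P=\mathbb{RP}^2$ be its projectivization and $P^*$ the projectivization of $V^*$. The polar coordinates are those of a Euclidean plane with origin $O$, viewed as an affine chart of $P$. Curves are allowed to have inflections and cusps: a curve (wave front) is the projection $(A,B)\mapsto A$ of a smooth Legendrian curve in the space of contact elements (pairs of a point $A\in P$ and a line $B\ni A$, with the contact structure given by the condition that the velocity of $A$ lies in $B$); the line $B$ is the tangent line. The dual curve $\gamma^*(t)\in P^*$ is the annihilator of the tangent line to $\gamma$ at $\gamma(t)$. A curve $\gamma(t)\subset P$, $t\in S^1=\mathbb R/2\pi\mathbb Z$, is self-dual if there exist a projective transformation $g\colon P\to P^*$ and a diffeomorphism $\varphi$ of $S^1$ such that $g(\gamma(\varphi(t)))=\gamma^*(t)$. Origin of the numbers $p,q,r$: for a self-dual curve, $g$ is induced by a linear isomorphism $f\colon V\to V^*$ and defines a bilinear form $F(v,w)=\langle f(v),w\rangle$ on $V$. For a point or line $B$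 of $P$ put $B^\perp=\{y\in P\mid F(y,x)=0 \text{ for all } x\in B\}$, and let $G\colon P\to P$ be the projective transformation $G(B)=(B^\perp)^\perp$. The setting is that of non-symmetric $F$ and of curves lying in the affine plane, star-shaped with respect to $O$ (no tangent line passes through $O$) and not a multiple of another curve, with $G$ the rotation about $O$ through the angle $2\pi p/q$, with $p,q$ coprime, and with parameterization chosen so that $\varphi^2(t)=t+2\pi r/q$, with $r,q$ coprime; then $G(\gamma(t))=\gamma(t+2\pi r/q)$, and the rotation number of $\gamma$ about $O$ equals the least positive $k$ such that $kr\equiv p \bmod q$. With $H$ the rotation about $O$ through $\pi p/q$ (so $H^2=G$), the duality sends a point $A$ to the line through $H(A)/|A|^2$ orthogonal to the vector $H(A)$.
   Formalization: The radius is e^{ρ_2(t)} instead of e^{ρ_1(t)}: with e^{ρ_1} the claim fails, e.g. for q=2, p=r=1, β=sin(2t)/4. The curve is taken closed on R/2πmZ for any m≥1 such that β is 2πm-periodic. *)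

(* Defs.v *)
From mathcomp Require Import all_boot all_order all_algebra.
From mathcomp Require Import all_classical all_reals all_analysis.

Set Implicit Arguments.
Unset Strict Implicit.
Unset Printing Implicit Defensive.

Import Order.TTheory GRing.Theory Num.Theory.
Import numFieldNormedType.Exports.

Local Open Scope classical_set_scope.
Local Open Scope ring_scope.

Definition smooth (R : realType) (V : normedModType R) (f : R -> V) : Prop :=
  forall (n : nat) (t : R), derivable (derive1n n f) t 1.

(* The circle of length T is R / TZ; it is the usual circle for T = 2 * pi.
   A smooth self-map of the circle is represented by a smooth lift R -> R. *)
Definition eq_circle (R : realType) (T s t : R) : Prop :=
  exists k : int, s = t + k%:~R * T.

Definition smooth_circle_map (R : realType) (T : R) (f : R -> R) : Prop :=
  smooth f /\ (forall s t : R, eq_circle T s t -> eq_circle T (f s) (f t)).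

Definition circle_diffeo (R : realType) (T : R) (phi : R -> R) : Prop :=
  smooth_circle_map T phi /\
  exists2 psi : R -> R, smooth_circle_map T psi &
    (forall t : R, eq_circle T (psi (phi t)) t) /\
    (forall t : R, eq_circle T (phi (psi t)) t).

(* V is R^3, seen as row vectors, and V^* is written in the dual basis, also as
   row vectors: <f, v> = v *m f^T.  Points of P and P^* are the row spaces of
   nonzero vectors, lines of P are the row spaces of 2 x 3 matrices of rank 2,
   so equality and incidence are :=: and <= in matrix_set_scope. *)

(* The covectors vanishing on the row space of B. *)
Definition annihilator (R : realType) (m : nat) (B : 'M[R]_(m, 3)) : 'M[R]_3 :=
  kermx B^T.

(* A closed Legendrian curve t |-> (A t, B t) in the space of contact elements,
   given by smooth homogeneous coordinates A of the point and a smooth frame B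
   of the line.  The velocity of the point in P is the derivative of A modulo
   A, and that of the line is the derivative of B modulo B; neither depends on
   the choice of coordinates or frame.  The last clause says that the
   Legendrian curve is immersed, while A itself may have cusps. *)
Definition legendrian (R : realType) (T : R)
    (A : R -> 'rV[R]_3) (B : R -> 'M[R]_(2, 3)) : Prop :=
  [/\ smooth A /\ smooth B,
      forall t : R, A t != 0 /\ row_free (B t),
      forall t : R, (A (t + T)%R :=: A t)%MS /\ (B (t + T)%R :=: B t)%MS,
      forall t : R, (A t <= B t)%MS /\ (derive1 A t <= B t)%MS &
      forall t : R, ~~ ((derive1 A t <= A t)%MS && (derive1 B t <= B t)%MS)].

(* B t is the tangent line at A t, and annihilator (B t) is the point of the
   dual curve; the projective transformation g : P -> P^* is induced by the
   invertible matrix M. *)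
Definition self_dual (R : realType) (T : R) (A : R -> 'rV[R]_3) : Prop :=
  exists2 B : R -> 'M[R]_(2, 3), legendrian T A B &
  exists (M : 'M[R]_3) (phi : R -> R),
    [/\ M \in unitmx, circle_diffeo T phi &
        forall t : R, (A (phi t) *m M :=: annihilator (B t))%MS].

(* The Euclidean plane is the affine chart (x, y) |-> [x : y : 1]. *)
Definition polar_point (R : realType) (theta r : R) : 'rV[R]_3 :=
  \row_(j < 3) [:: r * cos theta; r * sin theta; 1]`_j.

(* Which radius goes with which angle.  Let theta = t - beta t and let
   (theta, exp rho) be polar coordinates of a curve.  The foot of the
   perpendicular from the origin to the tangent line has polar angle
   theta - atan (rho' / theta').  This equals t + beta t exactly when
   rho' = (beta' - 1) tan (2 beta).  Symmetrically, the angle t + beta t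
   requires rho' = (beta' + 1) tan (2 beta).  Mismatched pairs need not be
   self-dual: with beta t = sin t / 2, the curve (t - beta t, exp rho) with
   rho' = (beta' + 1) tan (2 beta) is immersed and has inflections, whereas
   the dual of a curve with inflections has cusps. *)

(* Main.v *)
(* Put theta = t - beta - a and psi = t + beta - a with a = pi p / q.  The
   equation for rho2 says exactly that psi is the polar angle of the foot of the
   perpendicular from the origin to the tangent line, so this line is the
   row3 (cos psi, sin psi, - exp rho2 * cos (2 beta)).  Since beta (t + c) =
   - beta t, the shift t |-> t + c turns theta into psi + c, and
   K = exp (rho2 (t + c)) * exp (rho2 t) * cos (2 beta t) has zero derivative.
   Hence the rotation through - c followed by diag (1, 1, - K) maps the point at
   t + c to the tangent line at t.  The curve closes up because K is constant:
   this makes rho2 periodic of period 2 c, which is commensurable with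
   2 pi m. *)
Require Import Defs.
From mathcomp Require Import all_boot all_order all_algebra.
From mathcomp Require Import all_classical all_reals all_analysis.
From mathcomp Require Import ring lra.

Set Implicit Arguments.
Unset Strict Implicit.
Unset Printing Implicit Defensive.

Import Order.TTheory GRing.Theory Num.Theory.
Import numFieldNormedType.Exports.

Local Open Scope classical_set_scope.
Local Open Scope ring_scope.

(* The defining iteration of [smooth] turned inside out, so that inductions can
   peel off the innermost derivative. *)
Fixpoint derivable_upto (R : realType) (n : nat) (f : R -> R) : Prop :=
  if n is k.+1 then
    (forall t : R, derivable f t 1) /\ derivable_upto k (derive1 f)
  else True.

Lemma derivable_is_derive1 (R : realType) (V : normedModType R) (f : R -> V)
  (t : R) : derivable f t 1 -> is_derive t 1 f (derive1 f t).
Proof. by move=> df; rewrite derive1E; exact: derivableP. Qed.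

Lemma derive1_funE (R : realType) (f g : R -> R) :
  (forall t : R, is_derive t 1 f (g t)) -> derive1 f = g.
Proof. by move=> fg; apply/funext => t; rewrite derive1E; case: (fg t). Qed.

Lemma is_derive_derivable (R : realType) (f g : R -> R) :
  (forall t : R, is_derive t 1 f (g t)) -> forall t : R, derivable f t 1.
Proof. by move=> fg t; case: (fg t). Qed.

(** * Closure properties of smooth functions *)

Section smooth_closure.
Variable R : realType.
Implicit Types (f g : R -> R) (n : nat).

(** Both sides say that all iterated derivatives are derivable; [derive1Sn] moves the extra
    derivative from the outside to the inside. *)
Lemma smoothP f : smooth f <-> forall n, derivable_upto n f.
Proof.
have uptoP n g : derivable_upto n g <->
    forall k, (k < n)%N -> forall t : R, derivable (derive1n k g) t 1.
  elim: n g => [//|n IH] g /=; split.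
    move=> [dg /IH ug] [|k] kn t; first exact: dg.
    by rewrite derive1Sn; exact: ug.
  move=> ug; split=> [t|]; first exact: (ug 0%N).
  by apply/IH => k kn t; rewrite -derive1Sn; exact: ug.
split=> [sf n|uf n t]; first by apply/uptoP => k _; exact: sf.
by have /uptoP := uf n.+1; exact.
Qed.

Lemma smooth_derivable f : smooth f -> forall t : R, derivable f t 1.
Proof. by move=> sf; exact: (sf 0%N). Qed.

Lemma smooth_derive1 f : smooth f -> smooth (derive1 f).
Proof. by move=> sf n t; rewrite -derive1Sn; exact: sf. Qed.

(** Gives the smoothness of a function known only through a differential equation, such as
    [rho2]. *)
Lemma smooth_primitive f g :
  (forall t : R, is_derive t 1 f (g t)) -> smooth g -> smooth f.
Proof.
move=> fg /smoothP sg; apply/smoothP => -[//|n] /=; split.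
  exact: is_derive_derivable fg.
by rewrite (derive1_funE fg).
Qed.

Lemma derivable_uptoW n f : derivable_upto n.+1 f -> derivable_upto n f.
Proof.
by elim: n f => [//|n IH] f [df uf]; split=> //; exact: IH.
Qed.

Lemma derivable_upto_cst n (a : R) : derivable_upto n (fun=> a).
Proof.
elim: n a => [//|n IH] a; split=> [t|]; first exact: derivable_cst.
by rewrite (@derive1_funE _ _ (fun=> 0)).
Qed.

Lemma derivable_uptoD n f g : derivable_upto n f -> derivable_upto n g ->
  derivable_upto n (fun t => f t + g t).
Proof.
elim: n f g => [//|n IH] f g [df uf] [dg ug].
have D (t : R) : is_derive t 1 (fun t => f t + g t) (derive1 f t + derive1 g t).
  by apply: is_deriveD; exact: derivable_is_derive1.
split; first exact: is_derive_derivable D.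
by rewrite (derive1_funE D); exact: IH.
Qed.

Lemma derivable_uptoM n f g : derivable_upto n f -> derivable_upto n g ->
  derivable_upto n (fun t => f t * g t).
Proof.
elim: n f g => [//|n IH] f g uf ug.
have [df uf'] := uf; have [dg ug'] := ug.
have D (t : R) : is_derive t 1 (fun t => f t * g t)
    (f t * derive1 g t + g t * derive1 f t).
  by apply: is_deriveM; exact: derivable_is_derive1.
split; first exact: is_derive_derivable D.
rewrite (derive1_funE D).
by apply: derivable_uptoD; apply: IH => //; exact: derivable_uptoW.
Qed.

(** The derivative of 1/f is again a product of 1/f, 1/f and f', so the induction hypothesis on 1/f
    closes the argument. *)
Lemma derivable_uptoV n f : (forall t, f t != 0) -> derivable_upto n f ->
  derivable_upto n (fun t => (f t)^-1).
Proof.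
move=> f0; elim: n => [//|n IH] uf; have [df uf'] := uf.
have D (t : R) : is_derive t 1 (fun t => (f t)^-1)
    (-1 * ((f t)^-1 * (f t)^-1) * derive1 f t).
  have -> : -1 * ((f t)^-1 * (f t)^-1) * derive1 f t
      = - (f t) ^- 2 *: derive1 f t.
    by rewrite /GRing.scale/= -invrM ?unitfE// mulN1r -expr2.
  by apply: is_deriveV => //; exact: derivable_is_derive1.
split; first exact: is_derive_derivable D.
have uV := IH (derivable_uptoW uf).
rewrite (derive1_funE D).
apply: derivable_uptoM => //; apply: derivable_uptoM.
  exact: derivable_upto_cst.
exact: derivable_uptoM.
Qed.

(** The induction varies f, since the chain rule calls for the same claim about f'; full smoothness
    of f passes to f' without counting orders. *)
Lemma derivable_upto_comp n f g : smooth f -> derivable_upto n g ->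
  derivable_upto n (fun t => f (g t)).
Proof.
elim: n f => [//|n IH] f sf ug; have [dg ug'] := ug.
have D (t : R) :
    is_derive t 1 (fun t => f (g t)) (derive1 f (g t) * derive1 g t).
  apply: (is_derive1_comp (f := f)); last exact: derivable_is_derive1.
  exact/derivable_is_derive1/smooth_derivable.
split; first exact: is_derive_derivable D.
rewrite (derive1_funE D); apply: derivable_uptoM => //.
by apply: IH; [exact: smooth_derive1|exact: derivable_uptoW].
Qed.

Lemma smooth_cst (a : R) : smooth (fun _ : R => a).
Proof. by apply/smoothP => n; exact: derivable_upto_cst. Qed.

Lemma smooth_id : smooth (fun t : R => t).
Proof.
by apply: (smooth_primitive (g := fun=> 1)); exact: smooth_cst.
Qed.

Lemma smoothD f g : smooth f -> smooth g -> smooth (fun t => f t + g t).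
Proof.
by move=> /smoothP sf /smoothP sg; apply/smoothP => n; exact: derivable_uptoD.
Qed.

Lemma smoothM f g : smooth f -> smooth g -> smooth (fun t => f t * g t).
Proof.
by move=> /smoothP sf /smoothP sg; apply/smoothP => n; exact: derivable_uptoM.
Qed.

Lemma smoothN f : smooth f -> smooth (fun t => - f t).
Proof.
move=> sf; have -> : (fun t => - f t) = (fun t => -1 * f t).
  by apply/funext => t; rewrite mulN1r.
exact: smoothM (@smooth_cst (-1)) sf.
Qed.

Lemma smoothB f g : smooth f -> smooth g -> smooth (fun t => f t - g t).
Proof. by move=> sf sg; exact: smoothD sf (smoothN sg). Qed.

Lemma smoothV f : (forall t, f t != 0) -> smooth f ->
  smooth (fun t => (f t)^-1).
Proof.
by move=> f0 /smoothP sf; apply/smoothP => n; exact: derivable_uptoV.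
Qed.

Lemma smooth_comp f g : smooth f -> smooth g -> smooth (fun t => f (g t)).
Proof.
by move=> sf /smoothP sg; apply/smoothP => n; exact: derivable_upto_comp.
Qed.

Lemma smooth_expR : smooth (@expR R).
Proof.
apply/smoothP; elim=> [//|n IH]; split; first exact: is_derive_derivable.
by rewrite (@derive1_funE _ _ (@expR R)).
Qed.

Lemma smooth_sin_cos : smooth (@sin R) /\ smooth (@cos R).
Proof.
suff H n : derivable_upto n (@sin R) /\ derivable_upto n (@cos R).
  by split; apply/smoothP => n; have [] := H n.
elim: n => [//|n [IHs IHc]]; split; split.
- exact: is_derive_derivable.
- by rewrite (@derive1_funE _ _ (@cos R)).
- exact: is_derive_derivable.
- have D (t : R) : is_derive t 1 cos (-1 * sin t).
    by rewrite mulN1r; exact: is_derive_cos.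
  rewrite (derive1_funE D).
  by apply: derivable_uptoM => //; exact: derivable_upto_cst.
Qed.

(** Derivability of a matrix function is entrywise, but differentiating entrywise already needs
    derivability; hence one induction carries both facts. *)
Lemma smooth_mx (m n : nat) (A : R -> 'M[R]_(m, n)) :
  (forall i j, smooth (fun t => A t i j)) -> smooth A.
Proof.
move=> sA k; suff [] : (forall t : R, derivable (derive1n k A) t 1) /\
    forall t i j, derive1n k A t i j = derive1n k (fun t => A t i j) t by [].
elim: k => [|k [dk ek]].
  by split=> // t; apply/derivable_mxP => i j; exact: (sA i j 0%N).
have eS t i j : derive1n k.+1 A t i j = derive1n k.+1 (fun t => A t i j) t.
  rewrite !derive1nS !derive1E derive_mx// mxE.
  by congr ('D_1 _ t); apply/funext => s; exact: ek.
split; last exact: eS.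
move=> t; apply/(derivable_mxP (derive1n k.+1 A)) => i j.
by under eq_fun do rewrite eS; exact: (sA i j k.+1).
Qed.

End smooth_closure.

(** * Coordinates and lines in dimension three *)

Lemma ord2_ind (P : 'I_2 -> Prop) : P 0 -> P 1 -> forall i, P i.
Proof.
move=> P0 P1 [[|[|k]] k2]; last by [].
- by rewrite (_ : Ordinal k2 = 0) //; exact/val_inj.
- by rewrite (_ : Ordinal k2 = 1) //; exact/val_inj.
Qed.

Lemma ord3_ind (P : 'I_3 -> Prop) : P 0 -> P 1 -> P 2 -> forall i, P i.
Proof.
move=> P0 P1 P2 [[|[|[|k]]] k3]; last by [].
- by rewrite (_ : Ordinal k3 = 0) //; exact/val_inj.
- by rewrite (_ : Ordinal k3 = 1) //; exact/val_inj.
- by rewrite (_ : Ordinal k3 = 2) //; exact/val_inj.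
Qed.

Lemma big_ord3 (V : nmodType) (F : 'I_3 -> V) :
  \sum_j F j = F 0 + F 1 + F 2.
Proof.
rewrite !big_ord_recl big_ord0 addr0 addrA; congr (_ + F _ + F _);
  exact/val_inj.
Qed.

Definition row3 (R : realType) (x y z : R) : 'rV[R]_3 :=
  \row_(j < 3) [:: x; y; z]`_j.

Lemma mulmx_row3_tr (R : realType) (m : nat) (X : 'M[R]_(m, 3)) (x y z : R) i :
  (X *m (row3 x y z)^T) i 0 = X i 0 * x + X i 1 * y + X i 2 * z.
Proof. by rewrite mxE big_ord3 !mxE. Qed.

(** Each inclusion is an equality by comparing ranks: 1 and 3 - 2, then 2 and 3 - 1. The second part
    reduces membership in the line to one equation. *)
Lemma annihilator_line (R : realType) (B : 'M[R]_(2, 3)) (w : 'rV[R]_3) :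
  row_free B -> w != 0 -> B *m w^T = 0 ->
  (w :=: annihilator B)%MS /\ (B :=: kermx w^T)%MS.
Proof.
move=> /eqP Bfree w0 Bw; have rw : \rank w = 1%N by rewrite rank_rV w0.
split; apply/eqmxP.
  have wB : (w <= annihilator B)%MS.
    by apply/sub_kermxP; rewrite -[w]trmxK -trmx_mul Bw trmx0.
  by rewrite -(mxrank_leqif_eq wB) rw mxrank_ker mxrank_tr Bfree.
have Bw' : (B <= kermx w^T)%MS by exact/sub_kermxP.
by rewrite -(mxrank_leqif_eq Bw') Bfree mxrank_ker mxrank_tr rw.
Qed.

(** * A line through a point with prescribed normal direction *)

Section polar_curve.
Variable R : realType.

(** The line is spanned by the point and by the point at infinity orthogonal to the direction
    [psi]. *)
Definition tangent_frame (theta r psi : R) : 'M[R]_(2, 3) :=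
  \matrix_(i < 2) [:: polar_point theta r; row3 (- sin psi) (cos psi) 0]`_i.

(** Normal form of the same line: x cos psi + y sin psi = r cos (psi - theta). *)
Definition tangent_covector (theta r psi : R) : 'rV[R]_3 :=
  row3 (cos psi) (sin psi) (- (r * cos (psi - theta))).

Lemma tangent_frame_free (theta r psi : R) :
  row_free (tangent_frame theta r psi).
Proof.
apply: inj_row_free => u /rowP uB.
have uBE j : u 0 0 * tangent_frame theta r psi 0 j
    + u 0 1 * tangent_frame theta r psi 1 j = 0.
  move: (uB j); rewrite mxE !big_ord_recl big_ord0 addr0 [RHS]mxE => <-.
  by congr (_ + u 0 _ * tangent_frame _ _ _ _ _); exact/val_inj.
(* The last homogeneous coordinate is 1 for the point and 0 for the direction. *)
have u0 : u 0 0 = 0 by move: (uBE 2); rewrite !mxE/=; lra.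
have s0 : u 0 1 * sin psi = 0 by move: (uBE 0); rewrite u0 !mxE/=; lra.
have c0 : u 0 1 * cos psi = 0 by move: (uBE 1); rewrite u0 !mxE/=; lra.
have u1 : u 0 1 = 0.
  rewrite -[LHS]mulr1 -(cos2Dsin2 psi) mulrDr !expr2 !mulrA.
  by rewrite s0 c0 !mul0r addr0.
by apply/rowP; elim/ord2_ind; rewrite [RHS]mxE.
Qed.

Lemma tangent_covector_neq0 (theta r psi : R) :
  tangent_covector theta r psi != 0.
Proof.
apply/eqP => /rowP w0; move: (w0 0) (w0 1) (cos2Dsin2 psi); rewrite !mxE/=.
by move=> -> ->; lra.
Qed.

Lemma tangent_frame_covector (theta r psi : R) :
  tangent_frame theta r psi *m (tangent_covector theta r psi)^T = 0.
Proof.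
apply/matrixP => i j; rewrite (ord1 j) mulmx_row3_tr [RHS]mxE {j}.
elim/ord2_ind: i; rewrite !mxE/=; last by ring.
by rewrite cosB; ring.
Qed.

End polar_curve.

(** * The Legendrian lift of a curve in polar coordinates *)

Lemma is_derive1_mxE (R : realType) (m n : nat) (A : R -> 'M[R]_(m, n)) (t : R)
    i j (a : R) : smooth A -> is_derive t 1 (fun s => A s i j) a ->
  derive1 A t i j = a.
Proof.
move=> sA [_ <-]; rewrite derive1E derive_mx ?mxE//; exact: (sA 0%N).
Qed.

Section polar_legendrian.
Variable R : realType.
Variables theta r psi : R -> R.
Hypotheses (theta_smooth : smooth theta) (r_smooth : smooth r)
  (psi_smooth : smooth psi).

Let A t := polar_point (theta t) (r t).
Let B t := tangent_frame (theta t) (r t) (psi t).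

Let cos_smooth f : smooth f -> smooth (fun t : R => cos (f t)).
Proof. exact: smooth_comp (smooth_sin_cos R).2. Qed.

Let sin_smooth f : smooth f -> smooth (fun t : R => sin (f t)).
Proof. exact: smooth_comp (smooth_sin_cos R).1. Qed.

Let polar_point_coord_smooth j : smooth (fun t => A t 0 j).
Proof.
elim/ord3_ind: j; under eq_fun do rewrite mxE/=.
- exact: smoothM r_smooth (cos_smooth theta_smooth).
- exact: smoothM r_smooth (sin_smooth theta_smooth).
- exact: smooth_cst.
Qed.

Lemma polar_point_smooth : smooth A.
Proof.
by apply: smooth_mx => i j; rewrite (ord1 i); exact: polar_point_coord_smooth.
Qed.

Lemma tangent_frame_smooth : smooth B.
Proof.
apply: smooth_mx => i j; elim/ord2_ind: i.
  under eq_fun do rewrite mxE/=.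
  exact: polar_point_coord_smooth.
elim/ord3_ind: j; under eq_fun do rewrite !mxE/=.
- exact: smoothN (sin_smooth psi_smooth).
- exact: cos_smooth psi_smooth.
- exact: smooth_cst.
Qed.

Let is_derive_cos_comp (f : R -> R) (t : R) : smooth f ->
  is_derive t 1 (fun s => cos (f s)) (- sin (f t) * derive1 f t).
Proof.
move=> sf; apply: (is_derive1_comp (f := cos)).
exact/derivable_is_derive1/smooth_derivable.
Qed.

Let is_derive_sin_comp (f : R -> R) (t : R) : smooth f ->
  is_derive t 1 (fun s => sin (f s)) (cos (f t) * derive1 f t).
Proof.
move=> sf; apply: (is_derive1_comp (f := sin)).
exact/derivable_is_derive1/smooth_derivable.
Qed.

Lemma derive1_polar_point t : derive1 A t =
  row3 (derive1 r t * cos (theta t) - r t * derive1 theta t * sin (theta t))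
    (derive1 r t * sin (theta t) + r t * derive1 theta t * cos (theta t)) 0.
Proof.
have dr := derivable_is_derive1 (@smooth_derivable _ _ r_smooth t).
apply/rowP; elim/ord3_ind; apply: (is_derive1_mxE polar_point_smooth);
  rewrite mxE/=; under eq_fun do rewrite mxE/=.
- apply: (is_derive_eq (is_deriveM dr (is_derive_cos_comp t theta_smooth))).
  by rewrite /GRing.scale/=; ring.
- apply: (is_derive_eq (is_deriveM dr (is_derive_sin_comp t theta_smooth))).
  by rewrite /GRing.scale/=; ring.
- exact: is_derive_cst.
Qed.

Lemma derive1_tangent_frame t j : derive1 B t 1 j =
  row3 (- (derive1 psi t * cos (psi t))) (- (derive1 psi t * sin (psi t))) 0
    0 j.
Proof.
elim/ord3_ind: j; apply: (is_derive1_mxE tangent_frame_smooth);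
  rewrite mxE/=; under eq_fun do rewrite !mxE/=.
- apply: (is_derive_eq (is_deriveN (is_derive_sin_comp t psi_smooth))).
  by ring.
- apply: (is_derive_eq (is_derive_cos_comp t psi_smooth)).
  by ring.
- exact: is_derive_cst.
Qed.

Hypothesis r_neq0 : forall t, r t != 0.
Hypothesis tangency : forall t,
  derive1 r t * cos (psi t - theta t)
  + r t * derive1 theta t * sin (psi t - theta t) = 0.
Hypothesis immersed : forall t, ~ (derive1 theta t = 0 /\ derive1 psi t = 0).

(** The left side of [tangency] is the pairing of the velocity with [tangent_covector], so it
    expresses the contact condition. For immersion, a stationary point forces theta' = 0 and a
    stationary line forces psi' = 0. *)
Lemma polar_legendrian (m : nat) (T := 2 * pi * m%:R) :
  (forall t, theta (t + T) = theta t + T) -> (forall t, r (t + T) = r t) ->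
  (forall t, psi (t + T) = psi t + T) -> legendrian T A B.
Proof.
move=> thetaT rT psiT.
have Bw t := tangent_frame_covector (theta t) (r t) (psi t).
have lineE t := (annihilator_line (tangent_frame_free _ _ _)
  (tangent_covector_neq0 _ _ _) (Bw t)).2.
have T2pi : T = (pi *+ 2) *+ m by rewrite /T mulr_natl mulr_natr.
have cosT x : cos (x + T) = cos x by rewrite T2pi (periodicn (@cosD2pi R)).
have sinT x : sin (x + T) = sin x by rewrite T2pi (periodicn (@sinD2pi R)).
have AT t : A (t + T) = A t.
  by rewrite /A /polar_point thetaT rT cosT sinT.
split.
- split; [exact: polar_point_smooth | exact: tangent_frame_smooth].
- move=> t; split; last exact: tangent_frame_free.
  apply/eqP => /rowP/(_ 2); rewrite !mxE/= => /eqP; by rewrite oner_eq0.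
- move=> t; rewrite AT; split=> //.
  suff -> : B (t + T) = B t by [].
  rewrite /B /tangent_frame -[polar_point (theta (t + T)) _]/(A _) AT psiT.
  by rewrite cosT sinT.
- move=> t; split.
    have -> : A t = row 0 (B t) by apply/rowP => j; rewrite !mxE.
    exact: row_sub.
  rewrite lineE; apply/sub_kermxP/matrixP => i j; rewrite !ord1.
  rewrite mulmx_row3_tr derive1_polar_point !mxE/= -[RHS](tangency t).
  by rewrite cosB sinB; ring.
- move=> t; apply/negP => /andP[dA dB]; apply: (@immersed t).
  split.
    case/sub_rVP: dA => a; rewrite derive1_polar_point => dA.
    (* The velocity has last coordinate 0 and the point has 1, so the velocity vanishes outright. *)
    have a0 : a = 0 by move/rowP/(_ 2): dA; rewrite !mxE/= mulr1.
    have x0 := congr1 (fun v : 'rV_3 => v 0 0) dA.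
    have y0 := congr1 (fun v : 'rV_3 => v 0 1) dA.
    move: x0 y0; rewrite a0 scale0r !mxE/= => x0 y0.
    apply: (mulfI (r_neq0 t)); rewrite mulr0 -[LHS]mulr1.
    rewrite -(cos2Dsin2 (theta t)).
    have := congr1 ( *%R (sin (theta t))) x0.
    by have := congr1 ( *%R (cos (theta t))) y0; lra.
  (* The derivative of the second frame row pairs with the covector to - psi'. *)
  move: dB; rewrite lineE => /sub_kermxP/matrixP/(_ 1 0).
  rewrite mulmx_row3_tr !derive1_tangent_frame !mxE/= => h.
  rewrite -[LHS]mulr1 -(cos2Dsin2 (psi t)); lra.
Qed.

End polar_legendrian.

(** * Integer shifts, the duality matrix and shifts of the circle *)

Lemma shift_mulz (R : realType) (f : R -> R) (a e : R) (k : int) :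
  (forall t, f (t + a) = f t + e) ->
  forall t, f (t + k%:~R * a) = f t + k%:~R * e.
Proof.
move=> fa; have fn (n : nat) t : f (t + n%:R * a) = f t + n%:R * e.
  elim: n => [|n IH]; first by rewrite !mul0r !addr0.
  by rewrite -natr1 !mulrDl !mul1r !addrA fa IH.
case: k => n t; first exact: fn.
rewrite NegzE mulrNz -pmulrn !mulNr.
(* A negative multiple is undone by the natural case started at the shifted point. *)
by rewrite -[in RHS](subrK (n.+1%:R * a) t) fn addrK.
Qed.

(** On row vectors: rotation through - c, then, for K > 0, the polarity in the circle x^2 + y^2 = K,
    which sends (x, y) to the line with covector (x, y, - K). *)
Definition duality_mx (R : realType) (c K : R) : 'M[R]_3 :=
  \matrix_(i < 3) [:: row3 (cos c) (- sin c) 0;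
                      row3 (sin c) (cos c) 0;
                      row3 0 0 (- K)]`_i.

Lemma mulmx_duality (R : realType) (theta r c K : R) :
  polar_point theta r *m duality_mx c K =
  row3 (r * cos (theta - c)) (r * sin (theta - c)) (- K).
Proof.
apply/rowP; elim/ord3_ind; rewrite mxE big_ord3 !mxE/=.
- by rewrite cosB; ring.
- by rewrite sinB; ring.
- by ring.
Qed.

Lemma duality_mx_unit (R : realType) (c K : R) :
  K != 0 -> duality_mx c K \in unitmx.
Proof.
move=> K0.
(* The inverse has the same shape: the opposite rotation and the reciprocal of K. *)
suff /mulmx1_unit[] : duality_mx c K *m duality_mx (- c) K^-1 = 1%:M by [].
have cs := cos2Dsin2 c.
apply/matrixP; elim/ord3_ind; elim/ord3_ind;
  rewrite mxE big_ord3 !mxE/= ?cosN ?sinN; try ring; try by field.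
- by move: cs; lra.
- by move: cs; lra.
Qed.

Lemma circle_diffeo_shift (R : realType) (T c : R) :
  circle_diffeo T (fun t => t + c).
Proof.
have shift (a : R) : smooth_circle_map T (fun t => t + a).
  split; first exact: smoothD (@smooth_id R) (@smooth_cst R a).
  by move=> s t [k ->]; exists k; rewrite addrAC.
split; first exact: shift.
exists (fun t => t - c); first exact: shift.
by split=> t; exists 0; rewrite mul0r addr0 ?addrK ?subrK.
Qed.

(** * Closing up and self-duality of the curve *)

Theorem proposition20 (R : realType) (p r : int) (q : nat)
  (hq : (0 < q)%N) (hpq : coprimez p q%:Z) (hrq : coprimez r q%:Z)
  (c : R) (hc : c = pi * r%:~R / q%:R)
  (beta rho1 rho2 : R -> R)
  (beta_smooth : smooth beta)
  (beta_bound : forall t : R, `|beta t| < pi / 4)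
  (beta_anti : forall t : R, beta (t + c) = - beta t)
  (hrho1 : forall t : R,
     is_derive t 1 rho1 ((derive1 beta t + 1) * tan (2 * beta t)))
  (hrho2 : forall t : R,
     is_derive t 1 rho2 ((derive1 beta t - 1) * tan (2 * beta t)))
  (m : nat) (hm : (0 < m)%N)
  (beta_closed : forall t : R, beta (t + 2 * pi * m%:R) = beta t) :
  self_dual (2 * pi * m%:R)
    (fun t : R => polar_point (t - beta t - pi * p%:~R / q%:R) (expR (rho2 t))).
Proof.
set a := pi * p%:~R / q%:R; set T := 2 * pi * m%:R.
(* The bound on [beta] keeps 2 beta inside (- pi/2, pi/2), where the cosine is positive. *)
have cos2b_neq0 t : cos (2 * beta t) != 0.
  rewrite gt_eqF// cos_gt0_pihalf//.
  move: (beta_bound t); rewrite ltr_norml => /andP[b1 b2].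
  by apply/andP; split; lra.
have dbeta (t : R) : is_derive t 1 beta (derive1 beta t).
  exact/derivable_is_derive1/smooth_derivable.
have d_shift (f : R -> R) (t s d : R) : is_derive (t + s) 1 f d ->
    is_derive t 1 (fun x => f (x + s)) d.
  move=> df; rewrite -[d]mulr1.
  have sh : is_derive t 1 (fun x : R => x + s) 1 by exact: is_derive_shift.
  exact: (is_derive1_comp (g := fun x : R => x + s) df sh).
have dbeta_anti (t : R) : derive1 beta (t + c) = - derive1 beta t.
  have := @derive_val _ _ _ _ _ _ _ (d_shift _ _ _ _ (dbeta (t + c))).
  under eq_fun do rewrite beta_anti.
  by move=> <-; exact: (@derive_val _ _ _ _ _ _ _ (is_deriveN (dbeta t))).
pose E t := expR (rho2 (t + c)) * expR (rho2 t) * cos (2 * beta t).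
have [K EK] : exists K, forall t, E t = K.
  exists (E 0) => t; apply: is_derive_0_is_cst => {}t.
  have d1 := is_derive1_comp (is_derive_expR _)
    (d_shift _ _ _ _ (hrho2 (t + c))).
  have d2 := is_derive1_comp (is_derive_expR _) (hrho2 t).
  have d3 := is_derive1_comp (is_derive_cos _) (is_deriveZ 2 (dbeta t)).
  apply: (is_derive_eq (is_deriveM (is_deriveM d1 d2) d3)).
  (* By the sign changes, rho2 (t + c) has derivative (beta' + 1) tan (2 beta). Added to rho2' this
     gives 2 beta' tan (2 beta), which the logarithmic derivative of cos (2 beta) cancels. *)
  rewrite /GRing.scale/= dbeta_anti beta_anti mulrN tanN /tan.
  rewrite -[((_ \o _) * _) t]/(expR (rho2 (t + c)) * expR (rho2 t)).
  rewrite -[2 *: beta t]/(2 * beta t).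
  by field.
have K_neq0 : K != 0.
  by rewrite -(EK 0) !mulf_neq0// gt_eqF// expR_gt0.
(* Compare E at t + c and at t: the cosine is even and exp (rho2 (t + c)) is a common factor. The
   added 0 is the increment expected by [shift_mulz]. *)
have rho2_2c t : rho2 (t + 2 * c) = rho2 t + 0.
  rewrite addr0; apply: expR_inj.
  have := EK (t + c); rewrite -(EK t) /E beta_anti mulrN cosN.
  move=> /(mulIf (cos2b_neq0 t)); rewrite [RHS]mulrC => /(mulIf _) <-.
    by congr (expR (rho2 _)); ring.
  by rewrite gt_eqF// expR_gt0.
have [e rho2_T] : exists e, forall t, rho2 (t + T) = rho2 t + e.
  (* rho2' is T-periodic, so rho2 (t + T) - rho2 t is constant. *)
  exists (rho2 (0 + T) - rho2 0) => t.
  suff -> : rho2 (0 + T) - rho2 0 = rho2 (t + T) - rho2 t by ring.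
  apply: (is_derive_0_is_cst (f := fun t => rho2 (t + T) - rho2 t)) => {}t.
  have dT := d_shift _ _ _ _ (hrho2 (t + T)).
  apply: (is_derive_eq (is_deriveB dT (hrho2 t))).
  have -> : derive1 beta (t + T) = derive1 beta t.
    have := @derive_val _ _ _ _ _ _ _ (d_shift _ _ _ _ (dbeta (t + T))).
    by under eq_fun do rewrite beta_closed; move=> <-; rewrite derive1E.
  by rewrite beta_closed subrr.
(* The increment e satisfies r e = 0, as r T is a multiple of 2 c; and c = 0
   forces beta = 0. *)
have {}rho2_T t : rho2 (t + T) = rho2 t.
  have [r0|r0] := eqVneq r 0.
    have b0 x : beta x = 0.
      have := beta_anti x; rewrite hc r0 mulr0 mul0r addr0; lra.
    apply: is_derive_0_is_cst => x.
    by apply: is_derive_eq (hrho2 x) _; rewrite b0 mulr0 tan0 mulr0.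
  have := shift_mulz r rho2_T t.
  (* The factor q m comes from c = pi r / q and T = 2 pi m. *)
  have -> : r%:~R * T = (q * m)%N%:~R * (2 * c) :> R.
    rewrite hc /T -pmulrn natrM; field.
    by rewrite pnatr_eq0 -lt0n.
  rewrite (shift_mulz (q * m)%N rho2_2c t) mulr0 => /addrI/esym/eqP.
  rewrite mulf_eq0 intr_eq0 (negbTE r0)/= => /eqP e0.
  by rewrite rho2_T e0 addr0.
pose theta t := t - beta t - a; pose psi t := t + beta t - a.
have sub_angle t : psi t - theta t = 2 * beta t by rewrite /psi /theta; ring.
have theta_smooth : smooth theta.
  exact: smoothB (smoothB (@smooth_id R) beta_smooth) (@smooth_cst R a).
have psi_smooth : smooth psi.
  exact: smoothB (smoothD (@smooth_id R) beta_smooth) (@smooth_cst R a).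
have dtheta t : derive1 theta t = 1 - derive1 beta t.
  have D := @derive_val _ _ _ _ _ _ _ (is_deriveB
    (is_deriveB (is_derive_id t 1) (dbeta t)) (is_derive_cst a t 1)).
  by rewrite derive1E D subr0.
have dpsi t : derive1 psi t = 1 + derive1 beta t.
  have D := @derive_val _ _ _ _ _ _ _ (is_deriveB
    (is_deriveD (is_derive_id t 1) (dbeta t)) (is_derive_cst a t 1)).
  by rewrite derive1E D subr0.
have b2_smooth : smooth (fun t => 2 * beta t).
  exact: smoothM (@smooth_cst R 2) beta_smooth.
have rho2_smooth : smooth rho2.
  apply: (smooth_primitive hrho2).
  apply: (smoothM (smoothB (smooth_derive1 beta_smooth) (@smooth_cst R 1))).
  exact: smoothM (smooth_comp (smooth_sin_cos R).1 b2_smooth)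
    (smoothV cos2b_neq0 (smooth_comp (smooth_sin_cos R).2 b2_smooth)).
exists (fun t => tangent_frame (theta t) (expR (rho2 t)) (psi t)).
  apply: (polar_legendrian theta_smooth
    (smooth_comp (@smooth_expR R) rho2_smooth) psi_smooth).
  - by move=> t; rewrite gt_eqF// expR_gt0.
  (* Since psi - theta = 2 beta, tangency is the equation for [rho2] multiplied by exp rho2 * cos (2
     beta). *)
  - move=> t; rewrite sub_angle dtheta.
    have D := @derive_val _ _ _ _ _ _ _
      (is_derive1_comp (is_derive_expR _) (hrho2 t)).
    by rewrite derive1E D /tan; field.
  (* theta' + psi' = 2, so the two cannot vanish together. *)
  - by move=> t; rewrite dtheta dpsi => -[]; lra.
  - by move=> t; rewrite /theta beta_closed; ring.
  - by move=> t; rewrite rho2_T.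
  - by move=> t; rewrite /psi beta_closed; ring.
exists (duality_mx c K), (fun t => t + c); split.
- exact: duality_mx_unit.
- exact: circle_diffeo_shift.
move=> t; rewrite mulmx_duality beta_anti.
have [dualE _] := annihilator_line (tangent_frame_free _ _ _)
  (tangent_covector_neq0 _ _ _)
  (tangent_frame_covector (theta t) (expR (rho2 t)) (psi t)).
apply: (eqmx_trans _ dualE).
have -> : t + c - - beta t - a - c = psi t by rewrite /psi; ring.
(* The image is the tangent covector scaled by the radius at t + c; in the last coordinate this is E
   t = K. *)
suff -> : row3 (expR (rho2 (t + c)) * cos (psi t))
    (expR (rho2 (t + c)) * sin (psi t)) (- K) =
  expR (rho2 (t + c)) *: tangent_covector (theta t) (expR (rho2 t)) (psi t).
  by apply: eqmx_scale; rewrite gt_eqF// expR_gt0.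
apply/rowP; elim/ord3_ind; rewrite !mxE/=.
- by [].
- by [].
- by rewrite sub_angle -(EK t) /E; ring.
Qed.
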